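(* For every $i\in\mathbb{N}_0$ there is a quadtree configuration $T$ with $\mathrm{cap}(T)\ge 4^{-i}$, whose smallest assigned square is an $s$-square, such that every insertion of an $i$-square $Q$ into $T$ has total volume cost at least \[ \frac{3}{4}\cdot 4^{-i}\cdot\min\{s-i,\, i\}. \] Moreover, this lower bound is in $\Omega(|Q|\cdot h(T))$: there is an absolute constant $c>0$ such that for every $i\ge1$ the configuration $T$ can be chosen so that this lower bound is at least $c\cdot |Q|\cdot h(T)$.
   Context: The unit square $[0,1]^2$ is recursively subdivided as a quadtree of unbounded depth: the root (layer $0$) is $[0,1]^2$, and every node (pixel) of layer $j$ is an axis-parallel square of side $2^{-j}$ whose four children are its four quadrants. A pixel of layer $j$ is a $j$-pixel. For $r\in\mathbb{N}_0$, an $r$-square is an axis-parallel square of side $2^{-r}$, of volume $|Q|=4^{-r}$. A (quadtree) configuration $T$ assigns finitely many squares to pixels, each $j$-square to a $j$-pixel, at most one square per pixel, such that no pixel with an assigned square is a proper descendant of another pixel with an assigned square. A pixel $p$ contains a square if it is assigned to $p$ or to a descendant of $p$. A pixel with an assigned square is occupied. A non-occupied pixel is blocked if some ancestor is occupied, free otherwise; a free pixel is empty if it contains no square. The capacity $\mathrm{cap}(p)$ of a $j$-pixel $p$ is $0$ if $p$ is occupied or blocked, $4^{-j}$ if $p$ is empty, and otherwise the sum of the capacities of its four children; $\mathrm{cap}(T)$ is the capacity of the root. The height $h(T)$ is $0$ if the root is empty and otherwise the maximum of $r+1$ over all $r$ such that $T$ contains an $r$-square. A move takes a $j$-square assigned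 to a $j$-pixel $p$ and reassigns it to a $j$-pixel $q$ that is empty before the move; moves are performed one at a time. Inserting an $i$-square $Q$ into $T$ means performing a sequence of moves producing a configuration with an empty $i$-pixel and then assigning $Q$ to it. If $\{s_1,\dots,s_k\}$ is the set of squares moved during the insertion, its total volume cost is $\sum_{m=1}^k |s_m|$.
   Formalization: For i = 0, cap(T) ≥ 1 forces T to have no squares, so no smallest assigned square exists; in the first part the condition that the smallest assigned square is an s-square is required only for i ≥ 1 (the bound is 0 at i = 0). *)

(* Defs.v *)
(* Mathematical Components, with finmap for finite partial maps. *)
From mathcomp Require Import all_boot all_order all_algebra.
From mathcomp Require Import finmap.

Set Implicit Arguments.
Unset Strict Implicit.
Unset Printing Implicit Defensive.

Import Order.TTheory GRing.Theory Num.Theory.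
Local Open Scope ring_scope.
Local Open Scope fmap_scope.

(* The pixel [:: c_1; ...; c_j] is reached from the root by entering quadrant
   c_1, then c_2, ...: it is the square of side 2^-j whose lower left corner is
   (sum_k c_k.1 * 2^-k, sum_k c_k.2 * 2^-k).  Its layer is its length, and p is
   an ancestor of (or equal to) q exactly when p is a prefix of q. *)
Definition quadrant := (bool * bool)%type.
Definition pixel := seq quadrant.
Definition root : pixel := [::].
Definition layer (p : pixel) : nat := size p.
Definition child (p : pixel) (c : quadrant) : pixel := rcons p c.
Definition proper_descendant (q p : pixel) : bool := prefix p q && (q != p).

(* Squares of equal size are distinguished by a label, so that a square keeps
   its identity when it moves; (r, k) is an r-square. *)
Definition square := (nat * nat)%type.
Definition rank (Q : square) : nat := Q.1.

Definition volume (r : nat) : rat := 4%:R ^- r.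

Definition is_configuration (T : {fmap square -> pixel}) : Prop :=
  [/\ forall Q p, T.[? Q] = Some p -> layer p = rank Q,
      forall Q Q' p, T.[? Q] = Some p -> T.[? Q'] = Some p -> Q = Q'
    & forall Q Q' p p', T.[? Q] = Some p -> T.[? Q'] = Some p' ->
        ~~ proper_descendant p' p].

Record configuration := Configuration {
  assigned :> {fmap square -> pixel};
  configurationP : is_configuration assigned }.

Section Notions.
Variable T : {fmap square -> pixel}.
Implicit Type p : pixel.

Definition contains_square p : bool := has (prefix p) (codomf T).
Definition occupied p : bool := p \in codomf T.
Definition blocked p : bool :=
  ~~ occupied p && has (proper_descendant p) (codomf T).
Definition free p : bool := ~~ occupied p && ~~ blocked p.
Definition empty p : bool := free p && ~~ contains_square p.

Definition height : nat := \max_(Q <- domf T) (rank Q).+1.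

(* The recursion on the unbounded tree is cut off after n further layers;
   capE below shows that n = height is enough for the cut-off never to matter. *)
Fixpoint cap_rec (n : nat) p : rat :=
  if occupied p || blocked p then 0
  else if empty p then volume (layer p)
  else if n is n'.+1 then \sum_(c : quadrant) cap_rec n' (child p c)
  else 0.

Definition cap_pixel p : rat := cap_rec height p.
Definition cap : rat := cap_pixel root.

(* The smallest square has the largest rank. *)
Definition smallest_rank (s : nat) : Prop :=
  (exists2 Q, Q \in domf T & rank Q = s) /\
  (forall Q, Q \in domf T -> (rank Q <= s)%N).

End Notions.

Definition move (Q : square) (T T' : configuration) : Prop :=
  exists p q : pixel,
    [/\ (assigned T).[? Q] = Some p, layer q = rank Q, empty T q
      & assigned T' = (assigned T).[Q <- q]].

(* [moves T ms T']: performing moves of the squares listed in ms, one at a time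
   and in this order, turns T into T'. *)
Inductive moves : configuration -> seq square -> configuration -> Prop :=
| moves_nil T : moves T [::] T
| moves_cons T T' T'' Q ms :
    move Q T T' -> moves T' ms T'' -> moves T (Q :: ms) T''.

Definition insertion (Q : square) (T : configuration) (ms : seq square)
    (T' : configuration) : Prop :=
  Q \notin domf (assigned T) /\
  exists (T1 : configuration) (p : pixel),
    [/\ moves T ms T1, layer p = rank Q, empty T1 p
      & assigned T' = (assigned T1).[Q <- p]].

(* A square moved several times is paid for once. *)
Definition volume_cost (ms : seq square) : rat :=
  \sum_(Q <- undup ms) volume (rank Q).

(* s - i is not truncated: it is computed in rat. *)
Definition bound (i s : nat) : rat :=
  3%:R / 4%:R * volume i * Num.min (s%:R - i%:R) i%:R.

Lemma cap_rec_stable (T : configuration) n m p :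
  (height T <= n + layer p)%N -> (height T <= m + layer p)%N ->
  cap_rec T n p = cap_rec T m p.
Proof.
have E q : (height T <= layer q)%N -> ~~ (occupied T q || blocked T q) ->
    empty T q.
  move=> hq; rewrite negb_or /empty /free => -> /=.
  apply/hasPn => q' /codomfP[Q TQ]; apply/negP => /size_prefix qq'.
  have [sz _ _] := configurationP T.
  have Qd : Q \in domf (assigned T) by rewrite -fndSome TQ.
  have : ((rank Q).+1 <= height T)%N.
    exact: (@leq_bigmax_seq _ (enum_fset (domf (assigned T))) xpredT
             (fun Q => (rank Q).+1)).
  move/leq_trans/(_ hq); rewrite -(sz _ _ TQ) ltnNge.
  by rewrite /layer qq'.
elim: n m p => [|n IH] [|m] p //= hn hm.
- by case: ifPn => // /(E _ hn) ->.
- by case: ifPn => // /(E _ hm) ->.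
case: ifPn => // _; case: ifPn => // _; apply: eq_bigr => c _.
by apply: IH; rewrite /layer size_rcons addnS -addSn.
Qed.

Lemma capE (T : configuration) p :
  cap_pixel T p =
    if occupied T p || blocked T p then 0
    else if empty T p then volume (layer p)
    else \sum_(c : quadrant) cap_pixel T (child p c).
Proof.
rewrite /cap_pixel (@cap_rec_stable T _ (height T).+1) ?leq_addr //.
by rewrite addSn leqW ?leq_addr.
Qed.

(* Moves and insertions preserve configurations, so typing their results as
   configurations excludes nothing. *)
Lemma assign_empty (T : configuration) Q q :
  layer q = rank Q -> empty T q -> is_configuration (assigned T).[Q <- q].
Proof.
move=> qQ /andP[/andP[occ bl] cont]; have [sz inj anti] := configurationP T.
have far Q' p : (assigned T).[? Q'] = Some p -> ~~ prefix q p /\ ~~ prefix p q.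
  move=> TQ'; have pT : p \in codomf (assigned T) by apply/codomfP; exists Q'.
  split; first exact: (hasPn cont).
  apply/negP => pq; move: bl; rewrite /blocked occ /= => /hasPn/(_ p pT).
  by rewrite /proper_descendant pq /= negbK => /eqP eqp; rewrite /occupied eqp pT in occ.
split=> [Q' p|Q1 Q2 p|Q1 Q2 p p']; rewrite !fnd_set.
- by case: eqP => [-> [<-] //|_]; exact: sz.
- case: eqP => [->|_]; case: eqP => [->|_] //; last exact: inj.
    by move=> [<-] /far[]; rewrite prefix_refl.
  by move=> /[swap] -[<-] /far[]; rewrite prefix_refl.
- rewrite /proper_descendant; case: eqP => [_|_]; case: eqP => [_|_].
  + by move=> [<-] [<-]; rewrite eqxx andbF.
  + by move=> [<-] /far[/negbTE ->].
  + by move=> /far[_ /negbTE h] [<-]; rewrite h.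
  + exact: anti.
Qed.

(* Main.v *)
(* Every i-pixel g holds three (i+d+1)-squares for each d < i, nested towards
   one corner, where a single empty 2i-pixel is left; these holes have total
   volume 4^i * 4^(-2i) = 4^(-i).  The assigned squares and an i-pixel emptied
   for the insertion therefore fill the unit square exactly, so after the moves
   there is no free space elsewhere.  Counting 2i-pixels then shows that at
   least 3 * 4^d squares of rank i+d+1 have moved, of volume 3/4 * 4^(-i), and
   summing over the i levels gives the bound.  Here s = 2i and the height is
   2i+1, so that min(s-i, i) = i is proportional to the height. *)
Require Import Defs.
From mathcomp Require Import all_boot all_order all_algebra.
From mathcomp Require Import finmap.
From mathcomp Require Import zify ring lra.

Set Implicit Arguments.
Unset Strict Implicit.
Unset Printing Implicit Defensive.

Import Order.TTheory GRing.Theory Num.Theory.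
Local Open Scope ring_scope.

(** * Prefixes, disjoint unions and sums over sublists *)

Lemma prefix_comparable (T : eqType) (p q x : seq T) :
  prefix p x -> prefix q x -> (size p <= size q)%N -> prefix p q.
Proof.
rewrite !prefixE => /eqP px /eqP qx sz.
by rewrite -qx take_takel // px.
Qed.

Lemma prefix_size_eq (T : eqType) (p q : seq T) :
  prefix p q -> size p = size q -> p = q.
Proof. by rewrite prefixE => /eqP pq sz; rewrite -pq sz take_size. Qed.

Lemma prefix_nth (T : eqType) (x0 : T) (p q : seq T) k :
  prefix p q -> (k < size p)%N -> nth x0 q k = nth x0 p k.
Proof. by move=> /prefixP[s ->] kp; rewrite nth_cat kp. Qed.

Lemma card_bigcup_disjoint (I J : finType) (P : pred I) (F : I -> {set J}) :
  (forall t u x, P t -> P u -> x \in F t -> x \in F u -> t = u) ->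
  #|\bigcup_(t | P t) F t| = (\sum_(t | P t) #|F t|)%N.
Proof.
move=> inj; under [RHS]eq_bigr do rewrite -sum1_card big_mkcond.
rewrite -sum1_card [LHS]big_mkcond [RHS]exchange_big /=; apply: eq_bigr => x _.
case: bigcupP => [[t Pt xt]|none].
  rewrite (bigD1 t) //= xt big1 // => u /andP[Pu ut]; case: ifP => // xu.
  by rewrite (inj u t x) ?eqxx in ut.
by rewrite big1 // => t Pt; case: ifP => // xt; case: none; exists t.
Qed.

Lemma leq_card_bigcup (I J : finType) (P : pred I) (F : I -> {set J}) :
  (#|\bigcup_(t | P t) F t| <= \sum_(t | P t) #|F t|)%N.
Proof.
elim/big_ind2: _ => [|A m B n Am Bn|//]; first by rewrite cards0.
by rewrite (leq_trans (leq_card_setU _ _)) ?leq_add.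
Qed.

Lemma ler_sum_subseq (I : eqType) (s s' : seq I) (F : I -> rat) :
  uniq s -> uniq s' -> {subset s <= s'} -> (forall x, 0 <= F x) ->
  \sum_(x <- s) F x <= \sum_(x <- s') F x.
Proof.
move=> us us' ss' F0; rewrite [leRHS](bigID (mem s)) /= -(big_filter s').
rewrite [X in _ <= X + _](perm_big s) ?lerDl ?sumr_ge0 //.
apply: uniq_perm; rewrite ?filter_uniq // => x; rewrite mem_filter /=.
by case: (boolP (x \in s)) => //= /ss' ->.
Qed.

(** Counting layer-[n] pixels inside [p], with [n = i + i] below, replaces measuring areas. *)
Definition cells n (p : pixel) : {set n.-tuple quadrant} :=
  [set x : n.-tuple quadrant | prefix p x].

Lemma card_quadrant : #|{: quadrant}| = 4%N.
Proof. by rewrite card_prod card_bool. Qed.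

Lemma card_cells n p : (size p <= n)%N -> #|cells n p| = (4 ^ (n - size p))%N.
Proof.
move=> /subnKC; set k := (n - _)%N => <-.
rewrite -card_quadrant -card_tuple -[RHS]cardsT.
rewrite -(card_imset _ (f := cat_tuple (in_tuple p))) =>
    [|x y /(congr1 val)/eqP].
  congr #|pred_of_set _|; apply/setP => x; rewrite inE; apply/prefixP/imsetP.
    move=> [y xy]; have sy : size y == k.
      by rewrite -(eqn_add2l (size p)) -size_cat -xy size_tuple.
    by exists (Tuple sy); rewrite ?inE //; apply: val_inj.
  by move=> [y _ ->]; exists y.
by rewrite /= eqseq_cat // eqxx /= => /eqP /val_inj.
Qed.

(** * The comb: slots and their original pixels *)

Definition corner : quadrant := (false, false).

(** A triple of a group, a level and a quadrant. Keeping [corner] among the quadrants makes this a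
    plain finite product; [valid] discards it. *)
Definition slot (i : nat) : predArgType :=
  (i.-tuple quadrant * 'I_i * quadrant)%type.

Definition valid i (t : slot i) : bool := t.2 != corner.

(** What the squares of levels below [d] leave uncovered in the group [g]. *)
Definition gap i (g : i.-tuple quadrant) (d : nat) : pixel :=
  g ++ nseq d corner.

Definition home i (t : slot i) : pixel := child (gap t.1.1 t.1.2) t.2.

Lemma size_gap i (g : i.-tuple quadrant) d : size (gap g d) = (i + d)%N.
Proof. by rewrite size_cat size_tuple size_nseq. Qed.

Lemma size_home i (t : slot i) : size (home t) = (i + t.1.2).+1.
Proof. by rewrite size_rcons size_gap. Qed.

Lemma gap_inj i (g g' : i.-tuple quadrant) d : gap g d = gap g' d -> g = g'.
Proof.
move/eqP; rewrite eqseq_cat ?size_tuple // => /andP[/eqP gg' _].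
exact: val_inj.
Qed.

Lemma prefix_gap i (g : i.-tuple quadrant) d d' :
  (d <= d')%N -> prefix (gap g d) (gap g d').
Proof. by move=> /subnKC <-; rewrite /gap nseqD catA prefix_prefix. Qed.

Lemma nth_gap i (g : i.-tuple quadrant) d k :
  (i <= k)%N -> nth corner (gap g d) k = corner.
Proof.
by move=> ik; rewrite nth_cat size_tuple ltnNge ik /= nth_nseq if_same.
Qed.

Lemma nth_home i (t : slot i) : nth corner (home t) (i + t.1.2) = t.2.
Proof. by rewrite nth_rcons size_gap ltnn eqxx. Qed.

(** At index [i + t.1.2] the home has a letter other than [corner], whereas a gap has only [corner]
    from index [i] on. *)
Lemma homeN_prefix_gap i (t : slot i) (g : i.-tuple quadrant) k :
  valid t -> ~~ prefix (home t) (gap g k).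
Proof.
move=> vt; apply: contraNN vt => /(@prefix_nth _ corner _ _ (i + t.1.2)).
by rewrite nth_gap ?leq_addr // size_home nth_home => ->.
Qed.

(** A home of smaller layer would be a prefix of the gap whose child is [home u], which is
    impossible; at equal layers a prefix is an equality. *)
Lemma home_prefix_inj i (t u : slot i) :
  valid t -> valid u -> prefix (home t) (home u) -> t = u.
Proof.
move=> vt vu tu; have := size_prefix tu; rewrite !size_home ltnS leq_add2l.
rewrite leq_eqVlt => /orP[/eqP e|lt]; last first.
  have := homeN_prefix_gap u.1.1 u.1.2 vt; rewrite (prefix_comparable tu) //.
    exact: prefix_rcons.
  by rewrite size_home size_gap; lia.
have := prefix_size_eq tu; rewrite !size_home e => /(_ erefl).
case: t u e {vt vu tu} => [[g d] c] [[g' d'] c'] /= /val_inj ->.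
by move=> /rcons_inj[/gap_inj -> ->].
Qed.

(** * Counting slots and displaced squares *)

(** In one group, the squares of level [d] cover [3 * 4 ^ (i - d.+1)] pixels of layer [2i]; the
    levels from [K] on fill the gap of level [K] up to one such pixel. *)
Lemma sum_geom4 i K : (K <= i)%N ->
  (\sum_(d < i | K <= d) 3 * 4 ^ (i - d.+1) = 4 ^ (i - K) - 1)%N.
Proof.
move=> Ki; have [eKi|] := eqVneq K i.
  by rewrite eKi subnn big1 // => d; rewrite leqNgt ltn_ord.
elim: i Ki => [|i IH]; first by rewrite leqn0 => ->.
rewrite leq_eqVlt => /orP[->//|]; rewrite ltnS => Ki _.
rewrite big_mkcond big_ord_recr /= Ki subnn.
rewrite (eq_bigr (fun d : 'I_i =>
  4 * if (K <= d)%N then 3 * 4 ^ (i - d.+1) else 0))%N.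
  rewrite -big_distrr -big_mkcond /=; have [eKi|nKi] := eqVneq K i.
    rewrite eKi subSnn big1 // => d; by rewrite leqNgt ltn_ord.
  rewrite IH // subSn // expnS; have := expn_gt0 4 (i - K); lia.
by move=> d _; case: ifP => // _; rewrite subSn ?ltn_ord // expnS; lia.
Qed.

Lemma card_quadrantC1 : #|predC1 corner| = 3%N.
Proof. by rewrite cardC1 card_quadrant. Qed.

Lemma sum_slot_level i (F : nat -> nat) (P : pred nat) :
  (\sum_(t : slot i | valid t && P t.1.2) F t.1.2 =
   4 ^ i * \sum_(d < i | P d) 3 * F d)%N.
Proof.
rewrite (eq_bigl (fun t : slot i => P t.1.2 && (t.2 != corner))) =>
    [|t]; last by rewrite andbC.
rewrite -(pair_big (fun gd : i.-tuple quadrant * 'I_i => P gd.2)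
  (fun c => c != corner) (fun gd _ => F gd.2)) /=.
rewrite (eq_bigr (fun gd : i.-tuple quadrant * 'I_i => 3 * F gd.2)%N) =>
    [|gd _].
  rewrite -(pair_big xpredT (fun d : 'I_i => P d) (fun g d => 3 * F d)%N) /=.
  by rewrite sum_nat_const card_tuple card_quadrant.
by rewrite sum_nat_const card_quadrantC1.
Qed.

(* Nothing is free outside p, so the gap of a group at level d has three
   possible fates: it is tiled by smaller squares, which by volume happens for
   at most 4^i - 4^d.+1 of the 4^i groups; it is occupied by a displaced square
   of level d; or it lies under a larger square or under p, and then its three
   siblings are displaced.  With m displaced squares this gives
   4^d.+1 <= m + m / 3. *)
Lemma leq_card_displaced i (pos : slot i -> pixel) (p : pixel) (d : 'I_i) :
  (forall t, valid t -> size (pos t) = (i + t.1.2).+1) ->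
  (forall t u, valid t -> valid u -> prefix (pos t) (pos u) -> t = u) ->
  size p = i ->
  (forall t, valid t -> ~~ prefix p (pos t)) ->
  (3 * 4 ^ d <= #|[set t | [&& valid t, t.1.2 == d & pos t != home t]]|)%N.
Proof.
move=> szpos inj szp hole; set M := [set t | _].
(* The [2i]-pixels covered, after the moves, by squares of level at least [K]. *)
pose cover (K : nat) :=
  \bigcup_(t : slot i | valid t && (K <= t.1.2)%N) cells (i + i) (pos t).
have pos_le t : valid t -> (size (pos t) <= i + i)%N.
  by move=> /szpos ->; have := ltn_ord t.1.2; lia.
have sum_cells K : (K <= i)%N ->
    (\sum_(t : slot i | valid t && (K <= t.1.2)) #|cells (i + i) (pos t)| =
     4 ^ i * (4 ^ (i - K) - 1))%N.
  move=> Ki; rewrite -sum_geom4 //.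
  rewrite -(@sum_slot_level i (fun d => 4 ^ (i - d.+1))%N (fun d => K <= d)%N).
  apply: eq_bigr => t /andP[vt _]; rewrite card_cells ?pos_le // szpos //.
  by congr (_ ^ _)%N; have := ltn_ord t.1.2; lia.
(* The squares cover [4 ^ i * (4 ^ i - 1)] cells outside [p], and [p] has [4 ^ i] cells; together
   these are all [4 ^ (i + i)] cells. *)
have coverP x : (x \notin cover 0%N) -> prefix p x.
  have -> : cover 0%N = ~: cells (i + i) p; last by rewrite !inE negbK.
  apply/eqP; rewrite eqEcard; apply/andP; split.
    apply/bigcupsP => t /andP[vt _]; apply/subsetP => y; rewrite !inE => ty.
    apply: contra (hole t vt) => py; apply: (prefix_comparable py ty).
    by rewrite szp szpos //; lia.
  rewrite cardsCs setCK card_cells ?szp ?leq_addr // card_tuple card_quadrant.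
  rewrite card_bigcup_disjoint => [|t u y /andP[vt _] /andP[vu _]].
    by rewrite sum_cells // subn0 addnK expnD mulnBr muln1.
  rewrite !inE => ty uy.
  have [le|/ltnW le] := leqP (size (pos t)) (size (pos u)).
    exact/inj/(prefix_comparable ty uy).
  exact/esym/inj/(prefix_comparable uy ty).
(* The three fates of a gap: [A] tiled by smaller squares, [B] occupied by a displaced square of
   level [d], [C] with all three siblings displaced. *)
pose A := [set g : i.-tuple quadrant |
  cells (i + i) (gap g d.+1) \subset cover d.+1].
pose B := [set g : i.-tuple quadrant | [exists t in M, pos t == gap g d.+1]].
pose C := [set g : i.-tuple quadrant |
  [forall c, (c != corner) ==> ((g, d, c) \in M)]].
(* With [N = 4 ^ (i - d.+1)] cells per gap, [#|A| * N <= 4 ^ i * (N - 1)]; dividing by [N], a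
   divisor of [4 ^ i], gives the claim. *)
have cardA : (#|A| + 4 ^ d.+1 <= 4 ^ i)%N.
  have szg (g : i.-tuple quadrant) : (size (gap g d.+1) <= i + i)%N.
    by rewrite size_gap leq_add2l ltn_ord.
  have : (#|\bigcup_(g in A) cells (i + i) (gap g d.+1)| <= #|cover d.+1|)%N.
    by apply/subset_leq_card/bigcupsP => g; rewrite inE.
  rewrite card_bigcup_disjoint => [|g g' x _ _]; last first.
    rewrite !inE => gx g'x; apply: (@gap_inj _ _ _ d.+1).
    by apply: prefix_size_eq; rewrite ?(prefix_comparable gx g'x) // !size_gap.
  move/leq_trans/(_ (leq_card_bigcup _ _)); rewrite sum_cells //.
  under eq_bigr do rewrite card_cells // size_gap subnDl.
  rewrite sum_nat_const => le.
  rewrite -(leq_pmul2r (_ : 0 < 4 ^ (i - d.+1)))%N ?expn_gt0 //; move: le.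
  have -> : (4 ^ i = 4 ^ d.+1 * 4 ^ (i - d.+1))%N by rewrite -expnD subnKC.
  have : (0 < 4 ^ (i - d.+1))%N by rewrite expn_gt0.
  by case: (4 ^ (i - d.+1))%N => // N _; rewrite subn1 /= => le;
    rewrite mulnDl [leqRHS]mulnSr leq_add2r.
have cardB : (#|B| <= #|M|)%N.
  (* The first [i] letters of a position name the group that the square now lies in. *)
  pose group (t : slot i) : i.-tuple quadrant := insubd t.1.1 (take i (pos t)).
  rewrite (leq_trans _ (leq_imset_card group _)) //.
  apply/subset_leq_card/subsetP => g; rewrite inE => /exists_inP[t tM /eqP e].
  apply/imsetP; exists t => //; apply: val_inj.
  by rewrite /group e /gap take_size_cat ?size_tuple //
    val_insubd size_tuple eqxx.
have cardC : (#|C| * 3 <= #|M|)%N.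
  rewrite -card_quadrantC1 -[#|predC1 _|]cardsE -cardsX.
  pose sibling (gc : i.-tuple quadrant * quadrant) : slot i := (gc.1, d, gc.2).
  rewrite -(card_imset _ (f := sibling)).
    apply/subset_leq_card/subsetP => _ /imsetP[[g c] + ->].
    by rewrite !inE /= => /andP[/forallP/(_ c)/implyP gC /gC]; rewrite inE.
  by move=> [g c] [g' c'] /= [-> ->].
have ABC : [set: i.-tuple quadrant] \subset A :|: B :|: C.
  apply/subsetP => g _; rewrite !in_setU; case: (boolP (g \in A)) => //=.
  (* Some cell of the gap escapes the smaller squares, so it lies under a square of level at most
     [d] or under [p]. *)
  rewrite inE => /subsetPn[x]; rewrite inE => gx xNcover.
  have home_displaced c : c != corner -> pos (g, d, c) != home (g, d, c) ->
      (g, d, c) \in M.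
    by move=> c0 ne; rewrite inE ne eqxx /valid c0.
  have [/bigcupP[t /andP[vt _]]|/coverP px] := boolP (x \in cover 0%N).
    rewrite inE => tx.
    have td : (t.1.2 <= d)%N.
      rewrite leqNgt; apply: contra xNcover => dt.
      by apply/bigcupP; exists t; rewrite ?vt ?inE.
    move: td; rewrite leq_eqVlt => /orP[/eqP/val_inj td|td].
      (* At level exactly [d] the square fills the gap; it is displaced because no home is a prefix
         of a gap. *)
      have e : pos t = gap g d.+1.
        apply: prefix_size_eq; last by rewrite szpos // size_gap td addnS.
        by rewrite (prefix_comparable tx gx) // szpos // size_gap td addnS.
      apply/orP; left; rewrite inE; apply/exists_inP; exists t; rewrite ?e //.
      rewrite inE vt td eqxx /= e.
      by apply: contraNneq (homeN_prefix_gap g d.+1 vt) => <-;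
        apply: prefix_refl.
    (* A larger square contains [gap g d], hence the homes of all three siblings; a sibling still at
       home would be nested in it. *)
    apply/orP; right; rewrite inE.
    apply/forall_inP => c c0; apply: home_displaced => //.
    apply/eqP => e; have := inj t (g, d, c) vt c0; rewrite e.
    have /[swap] /[apply] : prefix (pos t) (home (g, d, c)).
      apply: prefix_trans (prefix_rcons _ _).
      apply: (prefix_comparable tx (prefix_trans (prefix_gap _ (leqnSn d)) gx)).
      by rewrite szpos // size_gap -addnS leq_add2l.
    by move=> tE; rewrite tE ltnn in td.
  apply/orP; right; rewrite inE.
  apply/forall_inP => c c0; apply: home_displaced => //.
  apply/eqP => e; have := hole (g, d, c) c0; rewrite e => /negP; apply.
  apply: prefix_trans (prefix_rcons _ _).
  apply: (prefix_comparable px (prefix_trans (prefix_gap _ (leqnSn d)) gx)).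
  by rewrite szp size_gap leq_addr.
(* Tripling [4 ^ i <= #|A| + #|B| + #|C|] leads to [12 * 4 ^ d <= 4 * #|M|]. *)
have := subset_leq_card ABC; rewrite cardsT card_tuple card_quadrant.
move=> /leq_trans/(_ (leq_card_setU _ _)).
move=> /leq_trans/(_ (leq_add (leq_card_setU _ _) (leqnn _))).
move: cardA cardB cardC; rewrite expnS.
by move: #|A| #|B| #|C| #|M| (4 ^ d)%N (4 ^ i)%N => a b c m k l; lia.
Qed.

(** * The comb as a configuration *)

(** The label encodes the home, so different homes give different squares and [comb_map] can decode
    the pixel from the square alone. *)
Definition comb_square i (t : slot i) : square :=
  (size (home t), choice.pickle (home t)).

Definition comb_map i : {fmap square -> pixel} :=
  [fmap Q : [fset comb_square t | t : slot i in [set t | valid t]]%fset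
    => odflt Defs.root (choice.unpickle (val Q).2)]%fmap.

Lemma comb_mapP i Q p :
  (comb_map i).[? Q]%fmap = Some p <->
  exists2 t : slot i, valid t & Q = comb_square t /\ p = home t.
Proof.
split.
  case/fndSomeP => Qd; rewrite ffunE /= => <-.
  have /imfsetP[t] := Qd; rewrite /= inE => vt Qt.
  exists t => //; split=> //; rewrite Qt.
  exact: (congr1 (odflt Defs.root) (choice.pickleK (home t))).
move=> [t vt [-> ->]]; apply/fndSomeP.
have td : comb_square t \in
    [fset comb_square t | t : slot i in [set t | valid t]]%fset.
  by apply/imfsetP; exists t; rewrite //= inE.
exists td; rewrite ffunE.
exact: (congr1 (odflt Defs.root) (choice.pickleK (home t))).
Qed.

Lemma comb_configuration i : is_configuration (comb_map i).
Proof.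
split=> [Q p|Q Q' p|Q Q' p p'].
- by move=> /comb_mapP[t _ [-> ->]].
- move=> /comb_mapP[t vt [-> ->]] /comb_mapP[u vu [-> e]].
  by rewrite (home_prefix_inj vt vu) // e prefix_refl.
- move=> /comb_mapP[t vt [_ ->]] /comb_mapP[u vu [_ ->]].
  apply/negP => /andP[tu].
  by rewrite (home_prefix_inj vt vu tu) eqxx.
Qed.

Definition comb i : configuration := Configuration (comb_configuration i).

(** * Emptiness and capacity *)

(** An assigned pixel at or above [p] makes it occupied or blocked, one at or below [p] is contained
    in it; what remains is incomparability. *)
Lemma emptyE (T : {fmap square -> pixel}) p :
  empty T p <->
  forall Q q, T.[? Q]%fmap = Some q -> ~~ prefix p q /\ ~~ prefix q p.
Proof.
split=> [/andP[/andP[occ bl] cont] Q q TQ|H].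
  have qT : q \in codomf T by apply/codomfP; exists Q.
  split; first exact: (hasPn cont).
  apply/negP => qp; move: bl; rewrite /blocked occ /= => /hasPn/(_ q qT).
  rewrite /proper_descendant qp /= negbK => /eqP pq.
  by rewrite /occupied pq qT in occ.
have occ : ~~ occupied T p.
  by apply/codomfP => -[Q /H[]]; rewrite prefix_refl.
apply/andP; split; last by apply/hasPn => q /codomfP[Q /H[]].
rewrite /Defs.free /blocked occ; apply/hasPn => q /codomfP[Q /H[_ qp]].
by rewrite /proper_descendant (negbTE qp).
Qed.

Lemma empty_child (T : {fmap square -> pixel}) p c :
  empty T p -> empty T (child p c).
Proof.
move=> /emptyE H; apply/emptyE => Q q /H[pq qp].
split; first by apply: contra pq => /(prefix_trans (prefix_rcons _ _)).
apply: contra pq => qc; have [sq|sq] := leqP (size q) (size p).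
  by rewrite (prefix_comparable qc (prefix_rcons _ _) sq) in qp.
rewrite (@prefix_size_eq _ q (child p c)) // ?prefix_rcons //.
by apply/eqP; rewrite eqn_leq (size_prefix qc) size_rcons.
Qed.

Lemma volume_ge0 r : 0 <= volume r.
Proof. by rewrite invr_ge0 exprn_ge0. Qed.

Lemma occupied_or_blocked (T : {fmap square -> pixel}) p :
  occupied T p || blocked T p = has (fun q => prefix q p) (codomf T).
Proof.
rewrite /blocked; case: (boolP (occupied T p)) => [Tp|/negP Tp] /=.
  by apply/esym/hasP; exists p; rewrite ?prefix_refl.
apply: eq_in_has => q Tq; rewrite /proper_descendant andbC.
by case: eqP => // pq; rewrite /occupied pq in Tp.
Qed.

Lemma volumeS r : volume r.+1 = volume r / 4%:R.
Proof. by rewrite /volume exprSr invfM. Qed.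

Lemma cap_pixel_empty (T : configuration) p :
  empty T p -> cap_pixel T p = volume (layer p).
Proof.
by move=> ep; rewrite capE ep; move: ep => /andP[/andP[/negbTE -> /negbTE ->]].
Qed.

(** Extends the recursion to the other cases: under an occupied or blocked pixel all capacities
    vanish, and an empty pixel has four empty children of a quarter of its volume. *)
Lemma cap_pixel_split (T : configuration) p :
  cap_pixel T p = \sum_(c : quadrant) cap_pixel T (child p c).
Proof.
have [ob|nob] := boolP (occupied T p || blocked T p).
  rewrite capE ob; move: ob; rewrite occupied_or_blocked => /hasP[q Tq qp].
  rewrite big1 // => c _; rewrite capE occupied_or_blocked ifT //.
  by apply/hasP; exists q => //; apply: prefix_trans (prefix_rcons _ _).
have [ep|nep] := boolP (empty T p); last first.
  by rewrite capE (negbTE nob) (negbTE nep).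
rewrite cap_pixel_empty //.
under eq_bigr do
  rewrite cap_pixel_empty ?empty_child // /layer size_rcons volumeS.
by rewrite sumr_const card_quadrant -[RHS]mulr_natr divfK.
Qed.

Lemma cap_pixel_ge0 (T : configuration) p : 0 <= cap_pixel T p.
Proof.
rewrite /cap_pixel; elim: (height T) p => [|n IH] p /=.
  by do 2?[case: ifP => // _]; exact: volume_ge0.
case: ifP => // _; case: ifP => // _; first exact: volume_ge0.
by apply: sumr_ge0 => c _.
Qed.

Lemma cap_pixel_cat (T : configuration) p x :
  cap_pixel T (p ++ x) <= cap_pixel T p.
Proof.
elim: x p => [|c x IH] p; first by rewrite cats0.
rewrite -cat_rcons (le_trans (IH _)) // [leRHS]cap_pixel_split (bigD1 c) //=.
by rewrite lerDl sumr_ge0 // => c' _; apply: cap_pixel_ge0.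
Qed.

Lemma cap_pixel_layer (T : configuration) v n p :
  (forall x, size x = n -> v <= cap_pixel T (p ++ x)) ->
  4%:R ^+ n * v <= cap_pixel T p.
Proof.
elim: n p => [|n IH] p H; first by rewrite mul1r -[p]cats0 H.
rewrite cap_pixel_split exprS -mulrA.
have -> : 4%:R * (4%:R ^+ n * v) = \sum_(c : quadrant) 4%:R ^+ n * v.
  by rewrite sumr_const card_quadrant mulr_natl.
apply: ler_sum => c _; apply: IH => x sx.
by rewrite /child cat_rcons H //= sx.
Qed.

(** * Capacity, ranks and height of the comb *)

(** Homes have layer at most [2i], so a home below this hole would equal it, yet no home is a prefix
    of a gap. *)
Lemma gap_empty i (g : i.-tuple quadrant) : empty (comb i) (gap g i).
Proof.
apply/emptyE => Q q /comb_mapP[t vt [_ ->]].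
split; last exact: homeN_prefix_gap.
apply: contra (homeN_prefix_gap g i vt) => gt.
rewrite -(prefix_size_eq gt) ?prefix_refl //.
apply/eqP; rewrite eqn_leq (size_prefix gt) size_home size_gap.
by rewrite -addnS leq_add2l ltn_ord.
Qed.

Lemma cap_comb i : volume i <= cap (comb i).
Proof.
(* One hole of layer [2i] in each of the [4 ^ i] groups. *)
have -> : volume i = 4%:R ^+ i * volume (i + i).
  by rewrite /volume exprD invfM mulrA mulfV ?mul1r // expf_neq0.
apply: cap_pixel_layer => x /eqP sx; rewrite cat0s.
have := cap_pixel_cat (comb i) x (nseq i corner); apply: le_trans.
rewrite (cap_pixel_empty (gap_empty (Tuple sx))).
by rewrite /layer size_gap.
Qed.

Lemma smallest_rank_comb i : (0 < i)%N -> smallest_rank (comb i) (i + i).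
Proof.
move=> i0; split=> [|Q Qd].
  have lt : (i.-1 < i)%N by rewrite prednK.
  (* A slot of the last level [i - 1], whose square has rank [2i]. *)
  pose t : slot i := ([tuple of nseq i corner], Ordinal lt, (true, true)).
  exists (comb_square t); last by rewrite /rank /= size_home /= -addnS prednK.
  by rewrite -fndSome (proj2 (comb_mapP _ _ (home t))) //; exists t.
move: Qd; rewrite -fndSome; case e : (_.[? _])%fmap => [p|] // _.
have /comb_mapP[t _ [-> _]] := e.
by rewrite /rank /= size_home -addnS leq_add2l ltn_ord.
Qed.

Lemma height_comb i : (0 < i)%N -> (height (comb i) <= (i + i).+1)%N.
Proof.
move=> /smallest_rank_comb[_ H]; apply/bigmax_leqP_seq => Q Qd _.
by rewrite ltnS H.
Qed.

(** * Cost of an insertion *)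

(** Lets the cost be bounded from the first and last configurations alone: every square keeps some
    position, and one found elsewhere must be listed in [ms]. *)
Lemma movesP T ms T1 : moves T ms T1 ->
  (forall Q, Q \notin ms ->
    (assigned T1).[? Q]%fmap = (assigned T).[? Q]%fmap) /\
  domf (assigned T1) = domf (assigned T).
Proof.
elim=> [//|{}T T' T'' Q {}ms [p [q [TQ _ _ T'E]]] _ [IHf IHd]].
split=> [R|].
  by rewrite inE negb_or => /andP[RQ /IHf ->]; rewrite T'E fnd_set (negbTE RQ).
rewrite IHd T'E; apply/fsetP => R; rewrite dom_setf !inE.
by case: eqP => // ->; rewrite -fndSome TQ.
Qed.

Lemma comb_square_inj i (t u : slot i) :
  valid t -> valid u -> comb_square t = comb_square u -> t = u.
Proof.
move=> vt vu [_ /(pcan_inj (@choice.pickleK _)) e].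
by apply: home_prefix_inj; rewrite // e prefix_refl.
Qed.

Lemma volume_cost_comb i Q ms T' : rank Q = i -> insertion Q (comb i) ms T' ->
  bound i (i + i) <= volume_cost ms.
Proof.
move=> Qi [_ [T1 [p [/movesP[fixed dom] pQ ep _]]]].
(* The default [root] only makes [pos] total; at valid slots the square is still assigned. *)
pose pos (t : slot i) := odflt Defs.root (assigned T1).[? comb_square t]%fmap.
have posE t : valid t -> (assigned T1).[? comb_square t]%fmap = Some (pos t).
  move=> vt; rewrite /pos; have : comb_square t \in domf (assigned T1).
    by rewrite dom -fndSome (proj2 (comb_mapP _ _ (home t))) //; exists t.
  by rewrite -fndSome; case: (_.[? _])%fmap.
have [sz inj anti] := configurationP T1.
pose M (d : 'I_i) := [set t | [&& valid t, t.1.2 == d & pos t != home t]].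
have cardM (d : 'I_i) : (3 * 4 ^ d <= #|M d|)%N.
  apply: (@leq_card_displaced i pos p) => [t vt|t u vt vu tu| |t vt].
  - by have := sz _ _ (posE t vt); rewrite /rank /= size_home.
  - apply: (comb_square_inj vt vu); apply: inj (posE t vt) _.
    rewrite posE //; congr Some; apply/esym/eqP.
    apply: contraNT (anti _ _ _ _ (posE t vt) (posE u vu)) => ne.
    by rewrite /proper_descendant tu eq_sym.
  - by rewrite -Qi.
  - by have /emptyE/(_ _ _ (posE t vt))[] := ep.
pose D := [set t : slot i | valid t && (pos t != home t)].
(* Different displaced slots give different squares of [ms], so each contributes its own term to the
   sum over [undup ms]. *)
have costD : \sum_(t in D) volume (i + t.1.2).+1 <= volume_cost ms.
  rewrite -big_enum /=.
  under eq_bigr => t _ do rewrite -size_home -[size _]/(rank (comb_square t)).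
  rewrite -(big_map (@comb_square i) xpredT (fun Q => volume (rank Q))).
  apply: ler_sum_subseq => [| |R /mapP[t]|R];
    rewrite ?undup_uniq ?volume_ge0 //.
    rewrite map_inj_in_uniq ?enum_uniq // => t u.
    by rewrite !mem_enum !inE => /andP[vt _] /andP[vu _];
      apply: comb_square_inj.
  rewrite mem_enum inE mem_undup => /andP[vt] + ->; apply: contraNT => /fixed.
  rewrite posE // (proj2 (comb_mapP _ _ (home t))) => [[->]//|].
  by exists t.
apply: le_trans costD.
rewrite (partition_big (fun t : slot i => t.1.2) xpredT) //=.
(* Each level contributes the same amount [3/4 * volume i]: the factor [4 ^ d] in the count cancels
   against the volume. *)
have -> : bound i (i + i) = \sum_(d < i) 3%:R * 4%:R ^+ d * volume (i + d).+1.
  rewrite /bound natrD addrK minxx.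
  under eq_bigr => d _.
    have -> : 3%:R * 4%:R ^+ d * volume (i + d).+1 = 3%:R / 4%:R * volume i.
      rewrite /volume exprS exprD !invfM.
      have : (4%:R ^+ d : rat) != 0 by rewrite expf_neq0.
      by move: (_ ^+ d) => x x0; field; rewrite x0 expf_neq0.
    over.
  by rewrite sumr_const card_ord mulr_natr.
apply: ler_sum => d _.
rewrite (eq_bigr (fun _ => volume (i + d).+1)) => [|t /andP[_ /eqP ->] //].
rewrite (eq_bigl (mem (M d))) => [|t]; last first.
  by rewrite !inE -andbA [(_ != _) && _]andbC.
rewrite sumr_const -[leRHS]mulr_natl ler_wpM2r ?volume_ge0 //.
by rewrite -natrX -natrM ler_nat cardM.
Qed.

Theorem theorem3 :
  (forall i : nat, exists (T : configuration) (s : nat),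
     [/\ volume i <= cap T,
         (0 < i)%N -> smallest_rank T s
       & forall (Q : square) (ms : seq square) (T' : configuration),
           rank Q = i -> insertion Q T ms T' -> bound i s <= volume_cost ms])
  /\
  (exists2 c : rat, 0 < c &
     forall i : nat, (1 <= i)%N -> exists (T : configuration) (s : nat),
       [/\ volume i <= cap T,
           smallest_rank T s,
           forall (Q : square) (ms : seq square) (T' : configuration),
             rank Q = i -> insertion Q T ms T' -> bound i s <= volume_cost ms
         & c * volume i * (height T)%:R <= bound i s]).
Proof.
split=> [i|].
  (* For [i = 0] the comb has no squares and the bound is [0]. *)
  exists (comb i), (i + i)%N; split;
    [exact: cap_comb | exact: smallest_rank_comb |].
  by move=> Q ms T'; exact: volume_cost_comb.
(* The constant comes from [height <= 2i + 1 <= 3i] for [i >= 1], against the factor [3/4 * i] in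
   the bound. *)
exists (4%:R^-1) => // i i0; exists (comb i), (i + i)%N.
split; [exact: cap_comb | exact: smallest_rank_comb | |].
  by move=> Q ms T'; exact: volume_cost_comb.
rewrite /bound natrD addrK minxx mulrAC [leRHS]mulrAC ler_wpM2r ?volume_ge0 //.
have := height_comb i0; rewrite -(ler_nat rat) -addn1 !natrD.
have : (1 : rat) <= i%:R by rewrite ler1n.
lra.
Qed.
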